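(* The ST-compatible ordered mixed quiver $Q_2$ of type $B_2$ described in the context is fruitful, i.e. every sequence of mutations at its mutable nodes $2$ and $5$ is admissible.
   Context: The quiver $Q_2$. Big nodes: $1,2,3,8$. Small nodes: $4,5,6,7$. Mutable nodes: $2$ (big) and $5$ (small); all others are frozen (never mutated). Arrows between big nodes, all parallel: $1\to2$, $2\to3$, $3\to8$, $8\to2$. Arrows between small nodes: $4\to5$, $5\to6$, $5\to7$, $7\to4$. Arrows between big and small nodes: $2\to5$, $5\to1$, $6\to2$. In addition there are three half-weight arrows between frozen nodes, $1\to4$, $3\to6$, $7\to8$. Ordering (tuples are listed by neighbors): $\mathrm{In}_\bullet(2)=(1)$, $\mathrm{Out}_\bullet(2)=()$, $\mathrm{In}_\circ(2)=(8)$, $\mathrm{Out}_\circ(2)=(3)$; the arrow $1\to2$ lies on side $\bullet$ of node $1$; the arrows at $3$ and at $8$ lie on sides $\circ$ of these nodes, with $\mathrm{In}_\circ(3)=(2)$, $\mathrm{Out}_\circ(3)=(8)$, $\mathrm{In}_\circ(8)=(3)$, $\mathrm{Out}_\circ(8)=(2)$. The ST-tiles are $\{1,2\}$ and $\{2,3,8\}$. Ordered mixed quivers. A mixed 2-colored quiver is a quiver (finite, no self-loops, no oriented 2-cycles) with big and small nodes such that the arrows between big nodes are partitioned into parallel (color $0$) and crossing (color $1$) arrows. Its pruned quiver $Q^{\mathrm{pr}}$ is obtained by deleting all small nodes and then all pairs formed by a parallel and a crossing arrow between the same two big nodes. An ordered mixed quiver carries, at every big node $k$, a splitting of the incoming and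 outgoing arrows of $Q^{\mathrm{pr}}$ at $k$ into ordered tuples $\mathrm{In}_f(k),\mathrm{Out}_f(k)$, $f\in\mathbb{Z}/2\mathbb{Z}$ (the two sides of the node; $\circ=0$, $\bullet=1$). An arrow of color $t$ from side $f$ of $i$ to side $g$ of $j$ is written $i\xrightarrow{f\,t\,g}j$. ST-compatibility. Let $\mathcal{Q}$ be the $\mathbb{Q}$-algebra generated by $X_i^{(f)},Y_i^{(f)}$ ($i$ big, $f\in\mathbb{Z}/2\mathbb{Z}$) with $X_i^{(f)}Y_i^{(f+1)}=Y_i^{(f)}X_i^{(f+1)}$ and $X_i^{(f)}Y_i^{(f+1)}$ central, together with one central variable for each small node, localized by its center; $\sigma:X_i^{(f)}\mapsto X_i^{(f+1)},Y_i^{(f)}\mapsto Y_i^{(f+1)}$ and $\tau:X_i^{(f)}\mapsto Y_i^{(f+1)},Y_i^{(f)}\mapsto X_i^{(f+1)}$ are commuting anti-automorphisms; $X_i:=X_i^{(0)}$. The angle on side $g$ of a big node $k$ is the ordered product $$\Delta_g(k)=\prod_{i\xrightarrow{f\,t\,g}k\ \in\,\mathrm{In}_g(k)}\sigma^f(\sigma\tau)^{t+1}(X_i)\cdot\sigma^g(X_k)\cdot\prod_{k\xrightarrow{g\,t\,f}j\ \in\,\mathrm{Out}_g(k)}\sigma^f(\sigma\tau)^{t+1}(X_j).$$ The quiver is ST-compatible if for every arrow $i\xrightarrow{f\,t\,g}j$ of $Q^{\mathrm{pr}}$ the relations $\Delta_f(i)=\sigma(\Delta_f(i))$ and $\Delta_g(j)=\sigma(\Delta_g(j))$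 are equivalent (imposing one implies the other). An ST-tile is a subquiver of $Q^{\mathrm{pr}}$ obtained by starting with a node and all arrows on one side of it, adding the nodes at the other ends, all arrows on the same side of those nodes, and so on. Structure (T): each big node lies in at most two tiles, one for each nonempty side; each tile is a locally transitive tournament (in-neighbors of each node, and out-neighbors of each node, are totally ordered); any three nodes of a tile form an oriented 3-cycle with an even number of crossing arrows or an acyclic triangle with an odd number of crossing arrows; and the cyclic order ''$\mathrm{In}_f(k),k,\mathrm{Out}_f(k)$'' of a tile is the same at all its nodes. Mutation of the underlying mixed 2-colored quiver at $k$: for every path $i\to k\to j$ add arrows $i\to j$; then reverse all arrows at $k$; then cancel opposite arrows (between big nodes only those of the same color). The added arrows are: if $k$ is big: one arrow of color the sum mod 2 of the two colors if $i,j$ are big; one arrow if exactly one of $i,j$ is big; two arrows if $i,j$ are small. If $k$ is small: one parallel and one crossing arrow if $i,j$ are both big; one arrow otherwise. (Equivalently: unfold by doubling all big nodes, parallel arrows connecting equal layers and crossing arrows opposite layers, each small node being connected to both copies; mutate simultaneously at both copies of $k$, resp. at $k$.) Mutation of the ordered structure. At a big node $k$ lying in two distinct tiles: the tiles not containing $k$ keep their nodes and cyclic orders; the two tiles containing $k$ are replaced by tiles with node sets $\mathrm{In}_\bullet(k)\cup\{k\}\cup\mathrm{Out}_\circ(k)$ and $\mathrm{In}_\circ(k)\cup\{k\}\cup\mathrm{Out}_\bullet(k)$, nodes other than $k$ keeping their sides; the order at $k$ becomes $\mathrm{In}_f(k,\mu_k(Q))=\mathrm{Out}_{f+1}(k,Q)$,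 $\mathrm{Out}_f(k,\mu_k(Q))=\mathrm{In}_f(k,Q)$, which fixes the cyclic orders of the new tiles. At a small node: all tiles keep their node sets, sides and cyclic orders. The mutation is admissible if with these tiles and cyclic orders the mutated quiver satisfies (T) (and hence is again ST-compatible). *)

(* Defs.v *)
From HB Require Import structures.
From mathcomp Require Import all_boot all_order all_algebra.

Set Implicit Arguments.
Unset Strict Implicit.
Unset Printing Implicit Defensive.

Import Order.TTheory GRing.Theory Num.Theory.
Local Open Scope ring_scope.

(* Z/2Z is [bool] with [addb].  Colors: parallel = 0, crossing = 1.
   Sides: white (the circle) = 0, black (the bullet) = 1. *)
Notation parallel := false (only parsing).
Notation crossing := true (only parsing).
Notation white := false (only parsing).
Notation black := true (only parsing).

(* [arr t i j] is the total weight of the arrows i -> j of color t.  Arrows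
   with a small end are uncolored; they are stored under color 0. *)
Record mixedQuiver (V : finType) := MixedQuiver {
  big : pred V;
  mutable : pred V;
  arr : bool -> V -> V -> rat
}.

Definition arr_tot (V : finType) (Q : mixedQuiver V) (i j : V) : rat :=
  arr Q parallel i j + arr Q crossing i j.

Definition mixed_quiver (V : finType) (Q : mixedQuiver V) : Prop :=
  [/\ forall t i j, 2 * arr Q t i j \is a Num.nat,
      forall t i j, mutable Q i || mutable Q j -> arr Q t i j \is a Num.nat,
      forall i j, ~~ (big Q i && big Q j) -> arr Q crossing i j = 0,
      forall t i, arr Q t i i = 0
    & forall i j, 0 < arr_tot Q i j -> arr_tot Q j i = 0].

(* Weights of the pruned quiver; without oriented 2-cycles the two arrows of a
   deleted parallel/crossing pair have the same direction. *)
Definition pr (V : finType) (Q : mixedQuiver V) (t : bool) (i j : V) : rat :=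
  if big Q i && big Q j
  then arr Q t i j - Num.min (arr Q t i j) (arr Q (~~ t) i j) else 0.

Definition pr_tot (V : finType) (Q : mixedQuiver V) (i j : V) : rat :=
  pr Q parallel i j + pr Q crossing i j.

(* Half-nodes: a node together with one of its sides. *)
Notation hnode V := (V * bool)%type (only parsing).

(* An entry [(i, f)] of [inn g k] stands for an arrow from side f of i to side g
   of k, an entry [(j, f)] of [out g k] for an arrow from side g of k to side f
   of j.  Its color need not be recorded: in the pruned quiver all the arrows
   i -> j have the same color, [col]. *)
Record ordQuiver (V : finType) := OrdQuiver {
  quiver :> mixedQuiver V;
  inn : bool -> V -> seq (hnode V);
  out : bool -> V -> seq (hnode V)
}.

Definition col (V : finType) (Q : mixedQuiver V) (i j : V) : bool :=
  0 < pr Q crossing i j.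

Definition ordered_mixed_quiver (V : finType) (Q : ordQuiver V) : Prop :=
  [/\ mixed_quiver Q,
      forall i j f g,
        count_mem (i, f) (inn Q g j) = count_mem (j, g) (out Q f i)
    & forall i j,
        pr_tot Q i j =
        (\sum_(f : bool) \sum_(g : bool) count_mem (i, f) (inn Q g j))%N%:R].

Definition narrows (V : finType) (Q : ordQuiver V) (x y : hnode V) : nat :=
  count_mem x (inn Q y.2 y.1).

Definition arrow (V : finType) (Q : ordQuiver V) (x y : hnode V) : bool :=
  x \in inn Q y.2 y.1.

(* ST-tiles are the connected components of the graph on half-nodes whose edges
   are the arrows of the pruned quiver. *)
Definition adj (V : finType) (Q : ordQuiver V) : rel (hnode V) :=
  fun x y => (y \in inn Q x.2 x.1) || (y \in out Q x.2 x.1).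

Definition tile (V : finType) (Q : ordQuiver V) (x : hnode V) : {set hnode V} :=
  [set y | connect (adj Q) x y].

Definition nonempty_side (V : finType) (Q : ordQuiver V) (f : bool) (k : V) :=
  inn Q f k ++ out Q f k != [::].

(* The cyclic order "In_f(k), k, Out_f(k)", up to rotation. *)
Definition cyc (V : finType) (Q : ordQuiver V) (x : hnode V) : seq (hnode V) :=
  inn Q x.2 x.1 ++ x :: out Q x.2 x.1.

Definition same_cyclic (T : eqType) (s1 s2 : seq T) : Prop :=
  exists n, s2 = rot n s1.

Definition oriented3 (V : finType) (Q : ordQuiver V) (x y z : hnode V) : bool :=
  [&& arrow Q x y, arrow Q y z & arrow Q z x].

Definition crossing_between (V : finType) (Q : mixedQuiver V) (i j : V) : bool :=
  col Q i j || col Q j i.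

(* First clause: a node lies in one tile for each nonempty side, so its two
   sides never belong to the same tile. *)
Definition structure_T (V : finType) (Q : ordQuiver V) : Prop :=
  [/\ forall k, (k, black) \notin tile Q (k, white),
      [/\ forall x y, y \in tile Q x -> x != y ->
            (narrows Q x y + narrows Q y x = 1)%N,
          forall x a b c, arrow Q a x -> arrow Q b x -> arrow Q c x ->
            arrow Q a b -> arrow Q b c -> arrow Q a c
        & forall x a b c, arrow Q x a -> arrow Q x b -> arrow Q x c ->
            arrow Q a b -> arrow Q b c -> arrow Q a c],
      forall x y z, y \in tile Q x -> z \in tile Q x -> uniq [:: x; y; z] ->
        odd (crossing_between Q x.1 y.1 + crossing_between Q y.1 z.1
             + crossing_between Q z.1 x.1)
        = ~~ (oriented3 Q x y z || oriented3 Q z y x)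
    & forall x y, y \in tile Q x -> same_cyclic (cyc Q x) (cyc Q y)].

(* Generators of the algebra attached to Q: [GX i f] and [GY i f] for big i,
   [GZ s] for small s. *)
Inductive gen (V : Type) := GX of V & bool | GY of V & bool | GZ of V.

Definition gen_of (V : finType) (Q : mixedQuiver V) (g : gen V) : bool :=
  match g with GX i _ | GY i _ => big Q i | GZ s => ~~ big Q s end.

Definition sigma_gen (V : Type) (g : gen V) : gen V :=
  match g with
  | GX i f => GX i (~~ f) | GY i f => GY i (~~ f) | GZ s => GZ s
  end.

Definition tau_gen (V : Type) (g : gen V) : gen V :=
  match g with
  | GX i f => GY i (~~ f) | GY i f => GX i (~~ f) | GZ s => GZ s
  end.

(* Monomials are words in the generators; sigma is an anti-automorphism. *)
Definition sigma_word (V : Type) (w : seq (gen V)) : seq (gen V) :=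
  rev (map (@sigma_gen V) w).

(* sigma^f (sigma tau)^(t+1) (X_i) *)
Definition angle_factor (V : Type) (f t : bool) (i : V) : gen V :=
  iter f (@sigma_gen V)
    (iter t.+1 (fun g => sigma_gen (tau_gen g)) (GX i white)).

Definition angle (V : finType) (Q : ordQuiver V) (x : hnode V) : seq (gen V) :=
  [seq angle_factor y.2 (col Q y.1 x.1) y.1 | y <- inn Q x.2 x.1]
  ++ iter x.2 (@sigma_gen V) (GX x.1 white)
  :: [seq angle_factor y.2 (col Q x.1 y.1) y.1 | y <- out Q x.2 x.1].

Definition eval_word (V : Type) (B : algType rat) (v : gen V -> B)
    (w : seq (gen V)) : B := \prod_(g <- w) v g.

(* Noncommutative polynomials, as formal linear combinations of words. *)
Definition ncpoly (V : Type) := seq (rat * seq (gen V)).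

Definition eval_ncpoly (V : Type) (B : algType rat) (v : gen V -> B)
    (p : ncpoly V) : B := \sum_(m <- p) m.1 *: eval_word v m.2.

Definition ncpoly_of (V : finType) (Q : mixedQuiver V) (p : ncpoly V) : bool :=
  all (fun m => all (gen_of Q) m.2) p.

Definition invertible (B : algType rat) (b : B) : Prop :=
  exists c, b * c = 1 /\ c * b = 1.

(* The algebra is described by its homomorphisms to arbitrary Q-algebras, i.e.
   by the images v of its generators.  [pre_hom] are the homomorphisms from the
   algebra in which only the central generators X_i^(f) Y_i^(f+1) and Z_s are
   inverted; [alg_hom] those from its localization by its center.  This
   intermediate step is needed: before it, X_i^(0) Y_i^(1) - X_i^(1) Y_i^(0) is
   a nonzero central element of square zero, so that inverting all the nonzero
   central elements at once would give the zero ring. *)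
Definition pre_hom (V : finType) (Q : mixedQuiver V) (B : algType rat)
    (v : gen V -> B) : Prop :=
  [/\ forall i f, big Q i ->
        v (GX i f) * v (GY i (~~ f)) = v (GY i f) * v (GX i (~~ f)),
      forall i f g, big Q i -> gen_of Q g ->
        GRing.comm (v (GX i f) * v (GY i (~~ f))) (v g),
      forall s g, ~~ big Q s -> gen_of Q g -> GRing.comm (v (GZ s)) (v g),
      forall i f, big Q i -> invertible (v (GX i f) * v (GY i (~~ f)))
    & forall s, ~~ big Q s -> invertible (v (GZ s))].

Definition central_poly (V : finType) (Q : mixedQuiver V) (p : ncpoly V) :=
  forall (B : algType rat) (v : gen V -> B), pre_hom Q v ->
  forall g, gen_of Q g -> GRing.comm (eval_ncpoly v p) (v g).

Definition zero_poly (V : finType) (Q : mixedQuiver V) (p : ncpoly V) :=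
  forall (B : algType rat) (v : gen V -> B), pre_hom Q v ->
  eval_ncpoly v p = 0.

Definition alg_hom (V : finType) (Q : mixedQuiver V) (B : algType rat)
    (v : gen V -> B) : Prop :=
  pre_hom Q v /\
  forall p, ncpoly_of Q p -> central_poly Q p -> ~ zero_poly Q p ->
    invertible (eval_ncpoly v p).

Definition angle_relation (V : finType) (Q : ordQuiver V) (B : algType rat)
    (v : gen V -> B) (x : hnode V) : Prop :=
  eval_word v (angle Q x) = eval_word v (sigma_word (angle Q x)).

Definition ST_compatible (V : finType) (Q : ordQuiver V) : Prop :=
  forall x y, arrow Q x y ->
  forall (B : algType rat) (v : gen V -> B), alg_hom Q v ->
    angle_relation Q v x <-> angle_relation Q v y.

Definition added (V : finType) (Q : mixedQuiver V) (k : V) (t : bool)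
    (i j : V) : rat :=
  if big Q i && big Q j then
    if big Q k then
      arr Q parallel i k * arr Q t k j + arr Q crossing i k * arr Q (~~ t) k j
    else arr_tot Q i k * arr_tot Q k j
  else if t then 0
  else if [&& big Q k, ~~ big Q i & ~~ big Q j]
  then 2 * (arr_tot Q i k * arr_tot Q k j)
  else arr_tot Q i k * arr_tot Q k j.

Definition before_cancel (V : finType) (Q : mixedQuiver V) (k : V) (t : bool)
    (i j : V) : rat :=
  if (i == k) || (j == k) then arr Q t j i else arr Q t i j + added Q k t i j.

Definition mutate_quiver (V : finType) (Q : mixedQuiver V) (k : V) :
    mixedQuiver V :=
  MixedQuiver (big Q) (mutable Q)
    (fun t i j => before_cancel Q k t i j
       - Num.min (before_cancel Q k t i j) (before_cancel Q k t j i)).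

(* After mutation at the big node k: the cyclic order of the tile on side f of
   k, which reads "new In_f(k), k, new Out_f(k)". *)
Definition new_cyc_at (V : finType) (Q : ordQuiver V) (k : V) (f : bool) :
    seq (hnode V) :=
  out Q (~~ f) k ++ (k, f) :: inn Q f k.

(* The cyclic order, after mutation at k, of the tile containing x. *)
Definition new_cyc (V : finType) (Q : ordQuiver V) (k : V) (x : hnode V) :
    seq (hnode V) :=
  if ~~ big Q k then cyc Q x
  else if x \in new_cyc_at Q k white then new_cyc_at Q k white
  else if x \in new_cyc_at Q k black then new_cyc_at Q k black
  else cyc Q x.

(* The elements of the cyclic sequence c other than x, read from x on. *)
Definition after (T : eqType) (x : T) (c : seq T) : seq T :=
  behead (rot (index x c) c).

(* Meaningful only when [admissible] holds: the neighbors of x in its tile are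
   listed in the prescribed cyclic order, sorted by the direction of the arrows
   of the mutated quiver. *)
Definition mutate (V : finType) (Q : ordQuiver V) (k : V) : ordQuiver V :=
  let Q' := mutate_quiver Q k in
  OrdQuiver Q'
    (fun f i => [seq y <- after (i, f) (new_cyc Q k (i, f))
                 | 0 < pr_tot Q' y.1 i])
    (fun f i => [seq y <- after (i, f) (new_cyc Q k (i, f))
                 | 0 < pr_tot Q' i y.1]).

Definition in_two_tiles (V : finType) (Q : ordQuiver V) (k : V) : Prop :=
  [/\ nonempty_side Q white k, nonempty_side Q black k
    & tile Q (k, white) != tile Q (k, black)].

Definition admissible (V : finType) (Q : ordQuiver V) (k : V) : Prop :=
  [/\ big Q k -> in_two_tiles Q k,
      ordered_mixed_quiver (mutate Q k),
      forall x, tile (mutate Q k) x =i new_cyc Q k x,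
      forall x, same_cyclic (new_cyc Q k x) (cyc (mutate Q k) x)
    & structure_T (mutate Q k)].

Definition fruitful (V : finType) (Q : ordQuiver V) : Prop :=
  forall (s : seq V) (k : V), all (mutable Q) s -> mutable Q k ->
  admissible (foldl (@mutate V) Q s) k.

Inductive node := N1 | N2 | N3 | N4 | N5 | N6 | N7 | N8.

Definition node_index (x : node) : 'I_8 :=
  match x with
  | N1 => @Ordinal 8 0 isT | N2 => @Ordinal 8 1 isT
  | N3 => @Ordinal 8 2 isT | N4 => @Ordinal 8 3 isT
  | N5 => @Ordinal 8 4 isT | N6 => @Ordinal 8 5 isT
  | N7 => @Ordinal 8 6 isT | N8 => @Ordinal 8 7 isT
  end.

Definition index_node (i : 'I_8) : node :=
  nth N1 [:: N1; N2; N3; N4; N5; N6; N7; N8] i.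

Lemma node_indexK : cancel node_index index_node.
Proof. by case. Qed.

HB.instance Definition _ := Finite.copy node (can_type node_indexK).

Definition Q2_arrows : seq (node * node) :=
  [:: (N1, N2); (N2, N3); (N3, N8); (N8, N2);
      (N4, N5); (N5, N6); (N5, N7); (N7, N4);
      (N2, N5); (N5, N1); (N6, N2)].

Definition Q2_half_arrows : seq (node * node) :=
  [:: (N1, N4); (N3, N6); (N7, N8)].

Definition Q2_quiver : mixedQuiver node :=
  MixedQuiver (mem [:: N1; N2; N3; N8]) (mem [:: N2; N5])
    (fun t i j => if t then 0 else
       (count_mem (i, j) Q2_arrows)%:R
       + (count_mem (i, j) Q2_half_arrows)%:R / 2).

Definition Q2_in (f : bool) (k : node) : seq (node * bool) :=
  match f, k with
  | black, N2 => [:: (N1, black)]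
  | white, N2 => [:: (N8, white)]
  | white, N3 => [:: (N2, white)]
  | white, N8 => [:: (N3, white)]
  | _, _ => [::]
  end.

Definition Q2_out (f : bool) (k : node) : seq (node * bool) :=
  match f, k with
  | black, N1 => [:: (N2, black)]
  | white, N2 => [:: (N3, white)]
  | white, N3 => [:: (N8, white)]
  | white, N8 => [:: (N2, white)]
  | _, _ => [::]
  end.

Definition Q2 : ordQuiver node := OrdQuiver Q2_quiver Q2_in Q2_out.

(* Main.v *)
(* ST-compatibility: since [X_k Y_k'] and [X_k' Y_k] are central and invertible, a
   factor [Y_k] at the end of an angle can be traded for a factor [X_k] at the
   other end; this carries the relation of one node of a tile to the next node.
   Fruitfulness: up to equality of all weights and orders, the mutations at 2 and
   5 generate only 24 ordered quivers, so all of them are checked by computation.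
   Their tiles are read off locally: the cyclic sequence of a half-node contains,
   with each member, all the neighbors of that member. *)

Require Import Defs.
From mathcomp Require Import all_boot all_order all_algebra.
From Stdlib Require Import FunctionalExtensionality.

Set Implicit Arguments.
Unset Strict Implicit.
Unset Printing Implicit Defensive.

Import Order.TTheory GRing.Theory Num.Theory.
Local Open Scope ring_scope.

(** * ST-compatibility *)

Section Exchange.
Variable B : algType rat.
Implicit Types a b c p q X Y : B.

Lemma invertible_mulrI c a b : invertible c -> c * a = c * b -> a = b.
Proof.
by case=> d [_ dc1] /(congr1 (fun z => d * z)); rewrite !mulrA dc1 !mul1r.
Qed.

Lemma invertible_mulIr c a b : invertible c -> a * c = b * c -> a = b.
Proof.
by case=> d [cd1 _] /(congr1 (fun z => z * d)); rewrite -!mulrA cd1 !mulr1.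
Qed.

Variables X X' Y Y' : B.
Hypotheses (XYE : X * Y' = Y * X') (YXE : X' * Y = Y' * X).
Hypotheses (XY_inv : invertible (X * Y')) (YX_inv : invertible (X' * Y)).
Hypotheses (XY_X : GRing.comm (X * Y') X) (XY_Y : GRing.comm (X * Y') Y).
Hypotheses (YX_X : GRing.comm (X' * Y) X) (YX_Y : GRing.comm (X' * Y) Y).
Variables p q : B.
Hypotheses (XY_p : GRing.comm (X * Y') p) (YX_p : GRing.comm (X' * Y) p).

(** Multiply [p * Y = Y' * q] by [X] on the left and by [X'] on the right; the factor
    [Y * X' = X * Y'] commutes with [X] and [p], so it cancels. For the converse multiply by [Y']
    and [Y] and cancel [Y' * X = X' * Y]. *)
Lemma exchange_right : p * Y = Y' * q <-> X * p = q * X'.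
Proof.
split=> E.
  apply: (invertible_mulrI XY_inv); rewrite (commrM XY_X XY_p) XYE.
  by rewrite mulrA -(mulrA X) E !mulrA XYE.
apply: (invertible_mulIr YX_inv); rewrite -(commrM YX_p YX_Y) {1}YXE.
by rewrite mulrA -(mulrA Y') E !mulrA.
Qed.

Lemma exchange_left : Y * p = q * Y' <-> p * X = X' * q.
Proof.
split=> E.
  apply: (invertible_mulIr YX_inv); rewrite -(commrM YX_p YX_X).
  by rewrite mulrA -(mulrA X') E YXE !mulrA.
apply: (invertible_mulrI XY_inv); rewrite (commrM XY_Y XY_p).
by rewrite mulrA -(mulrA Y) E XYE !mulrA.
Qed.

End Exchange.

Section Angles.
Variables (V : finType) (Q : mixedQuiver V) (B : algType rat) (v : gen V -> B).
Hypothesis vP : pre_hom Q v.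

Notation x i := (v (GX i white)).
Notation x' i := (v (GX i black)).
Notation y i := (v (GY i white)).
Notation y' i := (v (GY i black)).

Let facts i f : big Q i ->
  [/\ v (GX i f) * v (GY i (~~ f)) = v (GY i f) * v (GX i (~~ f)),
      invertible (v (GX i f) * v (GY i (~~ f)))
    & forall g, gen_of Q g ->
        GRing.comm (v (GX i f) * v (GY i (~~ f))) (v g)].
Proof.
by case: vP => vXY vcomm _ vinv _ bi; split=> [||g];
  [apply: vXY | apply: vinv | apply: vcomm].
Qed.

(** Trading the [y] factors of [j] in the first relation and those of [i] in the second turns both
    into [x' j * x' i = x i * x j]. *)
Lemma two_node_angles i j : big Q i -> big Q j ->
  x' i * y' j = y j * x i <-> y' i * x' j = x j * y i.
Proof.
move=> bi bj.
have [/= XYi ci_inv ci] := facts black bi; have [/= YXi di_inv di] := facts white bi.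
have [/= XYj cj_inv cj] := facts black bj; have [/= YXj dj_inv dj] := facts white bj.
apply: (iff_trans (@exchange_right _ (x' j) (x j) (y' j) (y j)
  XYj YXj cj_inv dj_inv _ _ _ _ _ _)); try by [apply: cj | apply: dj].
apply: iff_sym; apply: (@exchange_left _ (x' i) (x i) (y' i) (y i)
  XYi YXi ci_inv di_inv); by [apply: ci | apply: di].
Qed.

(* Both relations are equivalent to [X_k Y_i X_j = X_j' Y_i' X_k']. *)
Lemma three_node_angles i j k : big Q i -> big Q j -> big Q k ->
  y i * x j * y k = y' k * x' j * y' i <-> y j * x k * y i = y' i * x' k * y' j.
Proof.
move=> bi bj bk; rewrite -(mulrA (y' k)).
have [/= YXj dj_inv dj] := facts black bj; have [/= XYj cj_inv cj] := facts white bj.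
have [/= YXk dk_inv dk] := facts black bk; have [/= XYk ck_inv ck] := facts white bk.
apply: (iff_trans (@exchange_right _ (x k) (x' k) (y k) (y' k)
  XYk YXk ck_inv dk_inv _ _ _ _ _ _)); try by [apply: ck | apply: dk
    | apply: commrM; [apply: ck | apply: ck] | apply: commrM; [apply: dk | apply: dk]].
rewrite !mulrA -(mulrA (x' j)) -(mulrA (y j)); apply: iff_sym.
apply: (@exchange_left _ (x j) (x' j) (y j) (y' j) XYj YXj cj_inv dj_inv);
  by [apply: cj | apply: dj
    | apply: commrM; [apply: cj | apply: cj] | apply: commrM; [apply: dj | apply: dj]].
Qed.

End Angles.

Lemma Q2_ST_compatible : ST_compatible Q2.
Proof.
move=> s t st B v [vP _].
have b1 : big Q2 N1 by []. have b2 : big Q2 N2 by [].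
have b3 : big Q2 N3 by []. have b8 : big Q2 N8 by [].
have e12 := two_node_angles vP b1 b2.
(* The three rotations of the cyclic order 8, 2, 3 link the angles around the tile of these
   nodes. *)
have e823 := three_node_angles vP b8 b2 b3.
have e238 := three_node_angles vP b2 b3 b8.
have e382 := three_node_angles vP b3 b8 b2.
have angleE u w : angle Q2 u = w -> angle_relation Q2 v u <->
    \prod_(g <- w) v g = \prod_(g <- sigma_word w) v g.
  by rewrite /angle_relation /eval_word => ->.
(* All arrows are parallel, so a neighbour contributes [GY] and the node itself [GX], each on its
   own side. *)
have a1 := angleE (N1, black) [:: GX N1 black; GY N2 black] erefl.
have a2b := angleE (N2, black) [:: GY N1 black; GX N2 black] erefl.
have a2w := angleE (N2, white) [:: GY N8 white; GX N2 white; GY N3 white] erefl.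
have a3 := angleE (N3, white) [:: GY N2 white; GX N3 white; GY N8 white] erefl.
have a8 := angleE (N8, white) [:: GY N3 white; GX N8 white; GY N2 white] erefl.
move: a1 a2b a2w a3 a8; rewrite /sigma_word /= ![rev _]/=.
rewrite !big_cons big_nil !mulr1 !mulrA => a1 a2b a2w a3 a8.
by case: s t st => [[] []] [[] []] //= _; rewrite ?a1 ?a2b ?a2w ?a3 ?a8; tauto.
Qed.

(** * Certificates for admissibility *)

Section Tiles.
Variables (V : finType) (Q : ordQuiver V).

Definition cyc_closed : Prop :=
  forall x y z, y \in cyc Q x -> z \in cyc Q y -> z \in cyc Q x.

(** [cyc Q x] consists of [x] and its neighbours; closure makes it absorb every path from [x], by
    induction on the path extended at its end. *)
Lemma tile_cyc : cyc_closed -> forall x, tile Q x =i cyc Q x.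
Proof.
have adjE x y : y \in cyc Q x = (y == x) || adj Q x y.
  by rewrite /adj mem_cat inE orbCA.
move=> clQ x y; rewrite inE; apply/idP/idP; last first.
  by rewrite adjE => /predU1P[-> | /connect1]; rewrite ?connect0.
case/connectP=> p + ->.
elim/last_ind: p => [|p z IHp]; first by rewrite adjE eqxx.
rewrite rcons_path last_rcons => /andP[/IHp xp pz].
by apply: clQ xp _; rewrite adjE pz orbT.
Qed.

End Tiles.

Definition sound_quiver (V : finType) (Q : ordQuiver V) : Prop :=
  [/\ ordered_mixed_quiver Q, cyc_closed Q & structure_T Q].

(** Separates what is checked once per quiver from what depends on the mutation. The new tiles have
    the prescribed nodes because [cyc (mutate Q k) x] is both the tile and a rotation of
    [new_cyc Q k x]. *)
Lemma admissible_sound (V : finType) (Q : ordQuiver V) (k : V) :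
  sound_quiver Q -> sound_quiver (mutate Q k) ->
  (big Q k -> nonempty_side Q white k && nonempty_side Q black k) ->
  (forall x, same_cyclic (new_cyc Q k x) (cyc (mutate Q k) x)) ->
  admissible Q k.
Proof.
move=> [_ _ [twoQ _ _ _]] [omQ' clQ' TQ'] sideQ cycQ'; split=> //.
(* Equal tiles would put [(k, black)] in the tile of [(k, white)], against the first clause of
   [structure_T]. *)
- move=> /sideQ/andP[wk bk]; split=> //; apply/eqP => eq_tile.
  by have := twoQ k; rewrite eq_tile inE connect0.
- by move=> x y; rewrite (tile_cyc clQ'); have [n ->] := cycQ' x; rewrite mem_rot.
Qed.

(** * Boolean tests over the eight nodes and their sides *)

Definition nodes : seq node := [:: N1; N2; N3; N4; N5; N6; N7; N8].

Definition hnodes : seq (node * bool) :=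
  [seq (i, white) | i <- nodes] ++ [seq (i, black) | i <- nodes].

Lemma all_nodesP (P : pred node) : reflect (forall i, P i) (all P nodes).
Proof.
by apply: (iffP allP) => [allQ i | allQ i _]; [apply: allQ; case: i | apply: allQ].
Qed.

Lemma all_hnodesP (P : pred (node * bool)) :
  reflect (forall x, P x) (all P hnodes).
Proof.
by apply: (iffP allP) => [allQ x | allQ x _];
  [apply: allQ; case: x => [[] []] | apply: allQ].
Qed.

(** Rotating by [size s1] or more changes nothing, so a bounded search suffices. *)
Definition same_cyclicb (T : eqType) (s1 s2 : seq T) : bool :=
  has (fun n => s2 == rot n s1) (iota 0 (size s1).+1).

Lemma same_cyclicbP (T : eqType) (s1 s2 : seq T) :
  same_cyclicb s1 s2 -> same_cyclic s1 s2.
Proof. by case/hasP=> n _ /eqP ->; exists n. Qed.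

Section Checks.
Variable Q : ordQuiver node.

Definition weightsb (t : bool) (i j : node) : bool :=
  [&& 2 * arr Q t i j \is a Num.nat,
      mutable Q i || mutable Q j ==> (arr Q t i j \is a Num.nat),
      ~~ (big Q i && big Q j) ==> (arr Q crossing i j == 0)
    & arr Q t i i == 0].

(** The counts are listed black first, as [big_bool] expands the sums over sides. *)
Definition pairb (i j : node) : bool :=
  [&& weightsb white i j, weightsb black i j,
      (0 < arr_tot Q i j) ==> (arr_tot Q j i == 0)
    & pr_tot Q i j ==
      (count_mem (i, black) (inn Q black j) + count_mem (i, black) (inn Q white j)
       + (count_mem (i, white) (inn Q black j)
          + count_mem (i, white) (inn Q white j)))%N%:R].

Definition ordered_mixed_quiverb : bool :=
  all (fun i => all (pairb i) nodes) nodes &&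
  all (fun x => all (fun y => count_mem x (inn Q y.2 y.1) ==
                              count_mem y (out Q x.2 x.1)) hnodes) hnodes.

Lemma ordered_mixed_quiverbP : ordered_mixed_quiverb -> ordered_mixed_quiver Q.
Proof.
case/andP=> /all_nodesP pairQ /all_hnodesP countQ.
have {}pairQ i j : pairb i j by have /all_nodesP := pairQ i; apply.
have wQ t i j : weightsb t i j by case/and4P: (pairQ i j); case: t.
split.
- split=> [t i j|t i j ij|i j ij|t i|i j ij].
  + by case/and4P: (wQ t i j).
  + by case/and4P: (wQ t i j) => _ /implyP/(_ ij).
  + by case/and4P: (wQ white i j) => _ _ /implyP/(_ ij)/eqP.
  + by case/and4P: (wQ t i i) => _ _ _ /eqP.
  + by case/and4P: (pairQ i j) => _ _ /implyP/(_ ij)/eqP.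
- move=> i j f g; have /all_hnodesP/(_ (j, g))/eqP := countQ (i, f); exact.
- move=> i j; case/and4P: (pairQ i j) => _ _ _ /eqP ->.
  by rewrite !big_bool.
Qed.

Definition cyc_closedb : bool :=
  all (fun x => all (fun y => all (fun z => z \in cyc Q x) (cyc Q y)) (cyc Q x))
    hnodes.

Lemma cyc_closedbP : cyc_closedb -> cyc_closed Q.
Proof.
by move=> /all_hnodesP clQ x y z; move/allP: (clQ x) => /[apply]/allP; apply.
Qed.

Definition transitiveb (s : seq (node * bool)) : bool :=
  all (fun a => all (fun b => all (fun c =>
    arrow Q a b ==> arrow Q b c ==> arrow Q a c) s) s) s.

Lemma transitivebP s a b c : transitiveb s -> a \in s -> b \in s -> c \in s ->
  arrow Q a b -> arrow Q b c -> arrow Q a c.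
Proof.
by move=> /allP + sa sb sc ab bc => /(_ a sa)/allP/(_ b sb)/allP/(_ c sc);
  rewrite ab bc.
Qed.

Definition triangleb (x y z : node * bool) : bool :=
  uniq [:: x; y; z] ==>
    (odd (crossing_between Q x.1 y.1 + crossing_between Q y.1 z.1
          + crossing_between Q z.1 x.1)
     == ~~ (oriented3 Q x y z || oriented3 Q z y x)).

(** Quantifiers over the tile range over [cyc Q x], equal to it by [tile_cyc], so [connect] is never
    computed. *)
Definition tileb (x : node * bool) : bool :=
  [&& (x.1, ~~ x.2) \notin cyc Q x,
      transitiveb (inn Q x.2 x.1), transitiveb (out Q x.2 x.1)
    & all (fun y => [&& (x != y) ==> (narrows Q x y + narrows Q y x == 1)%N,
                        same_cyclicb (cyc Q x) (cyc Q y)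
                      & all (triangleb x y) (cyc Q x)]) (cyc Q x)].

Definition structure_Tb : bool := all tileb hnodes.

Lemma structure_TbP :
  ordered_mixed_quiver Q -> cyc_closed Q -> structure_Tb -> structure_T Q.
Proof.
move=> [_ countQ _] clQ /all_hnodesP tileQ.
have tileE := tile_cyc clQ.
(* [arrow] reads [inn], while transitivity among out-neighbours is tested on [out]; the matching
   counts bridge the two. *)
have outQ x y : arrow Q x y -> y \in out Q x.2 x.1.
  by case: x y => [i f] [j g]; rewrite /arrow -!has_pred1 !has_count countQ.
split.
- by move=> k; rewrite tileE; case/and4P: (tileQ (k, white)).
- split=> [x y|x a b c|x a b c].
  + rewrite tileE => xy nxy; case/and4P: (tileQ x) => _ _ _ /allP/(_ y xy).
    by case/and3P=> /implyP/(_ nxy)/eqP.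
  + by case/and4P: (tileQ x) => _ + _ _; apply: transitivebP.
  + case/and4P: (tileQ x) => _ _ + _ /outQ + /outQ + /outQ.
    exact: transitivebP.
- move=> x y z; rewrite !tileE => xy xz uxyz.
  case/and4P: (tileQ x) => _ _ _ /allP/(_ y xy)/and3P[_ _ /allP/(_ z xz)].
  by move/implyP/(_ uxyz)/eqP.
- move=> x y; rewrite tileE => xy.
  by case/and4P: (tileQ x) => _ _ _ /allP/(_ y xy)/and3P[_ /same_cyclicbP].
Qed.

Definition sound_quiverb : bool :=
  [&& ordered_mixed_quiverb, cyc_closedb & structure_Tb].

Lemma sound_quiverbP : sound_quiverb -> sound_quiver Q.
Proof.
case/and3P=> /ordered_mixed_quiverbP omQ /cyc_closedbP clQ TQ.
by split=> //; apply: structure_TbP.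
Qed.

End Checks.

Lemma Q2_sound : sound_quiver Q2.
Proof. by apply: sound_quiverbP; vm_compute. Qed.

(** * The mutation class of [Q2] *)

Definition tabulate (T : Type) (F : node -> T) : seq T := map F nodes.

Definition lookup (T : Type) (x0 : T) (s : seq T) (i : node) : T :=
  nth x0 s (node_index i).

Lemma lookup_tabulate (T : Type) (x0 : T) F i : lookup x0 (tabulate F) i = F i.
Proof. by case: i. Qed.

Definition at_bool (T : Type) (p : T * T) (f : bool) : T := if f then p.2 else p.1.

(* The weights, [inn] and [out] of a quiver with the big and mutable nodes of
   [Q2]; tabulating makes iterated mutations computable and comparable. *)
Definition table : eqType :=
  (seq (seq (rat * rat)) * seq (seq (node * bool) * seq (node * bool))
   * seq (seq (node * bool) * seq (node * bool)))%type.

Definition encode (Q : ordQuiver node) : table :=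
  (tabulate (fun i => tabulate (fun j => (arr Q white i j, arr Q black i j))),
   tabulate (fun k => (inn Q white k, inn Q black k)),
   tabulate (fun k => (out Q white k, out Q black k))).

Definition decode (d : table) : ordQuiver node :=
  let: (w, a, b) := d in
  OrdQuiver
    (MixedQuiver (big Q2) (mutable Q2)
       (fun t i j => at_bool (lookup (0, 0) (lookup [::] w i) j) t))
    (fun f k => at_bool (lookup ([::], [::]) a k) f)
    (fun f k => at_bool (lookup ([::], [::]) b k) f).

Lemma encodeK (Q : ordQuiver node) :
  big Q = big Q2 -> mutable Q = mutable Q2 -> decode (encode Q) = Q.
Proof.
case: Q => [[bQ mQ aQ] iQ oQ] /= -> ->; rewrite /decode /=.
congr OrdQuiver; [congr MixedQuiver | |].
- apply: functional_extensionality => t; do 2![apply: functional_extensionality => ?].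
  by rewrite !lookup_tabulate; case: t.
- apply: functional_extensionality => f; apply: functional_extensionality => k.
  by rewrite lookup_tabulate; case: f.
- apply: functional_extensionality => f; apply: functional_extensionality => k.
  by rewrite lookup_tabulate; case: f.
Qed.

Definition mutate_table (k : node) (d : table) : table :=
  encode (mutate (decode d) k).

(** Twelve tables along the alternating mutations 2, 5, 2, 5, ...: [s] holds the even steps, its
    image under mutation at 2 the odd ones. *)
Definition mutation_cycle (d : table) : seq table :=
  let s := traject (fun c => mutate_table N5 (mutate_table N2 c)) d 6 in
  s ++ map (mutate_table N2) s.

(* Mutating alternately at 2 and 5 comes back to [Q2] after 12 steps, whereas
   mutating twice at 2 exchanges the two sides of node 2. *)
Definition mutation_class : seq table :=
  mutation_cycle (encode Q2) ++
  mutation_cycle (mutate_table N2 (mutate_table N2 (encode Q2))).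

Definition edgeb (d : table) (k : node) : bool :=
  let Q := decode d in
  let d' := mutate_table k d in
  [&& d' \in mutation_class,
      big Q k ==> (nonempty_side Q white k && nonempty_side Q black k)
    & all (fun x => same_cyclicb (new_cyc Q k x) (cyc (decode d') x)) hnodes].

Lemma mutation_class_sound :
  all (fun d => sound_quiverb (decode d)) mutation_class.
Proof. by vm_compute. Qed.

Lemma mutation_class_edges :
  all (fun d => edgeb d N2 && edgeb d N5) mutation_class.
Proof. by vm_compute. Qed.

(** Mutation preserves the big and mutable nodes, which tables leave out, so tabulating between
    mutations loses nothing. *)
Lemma decode_mutate d k : decode (mutate_table k d) = mutate (decode d) k.
Proof. by apply: encodeK; case: d => [[]]. Qed.

Lemma mutation_class_edge d k : d \in mutation_class ->
  mutable (decode d) k -> edgeb d k.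
Proof.
move=> dC mk; have /andP[e2 e5] := allP mutation_class_edges d dC.
have : mutable Q2 k by case: d mk {dC e2 e5} => [[]].
by rewrite /= !inE => /orP[] /eqP ->.
Qed.

Lemma mutation_class_fruitful d :
  d \in mutation_class -> fruitful (decode d).
Proof.
(* The table stays general in the induction: each mutation of the sequence moves to another member
   of the class. *)
move=> dC s k; elim: s d dC => [|l s IHs] d dC /=; last first.
  case/andP=> /(mutation_class_edge dC)/and3P[d'C _ _] ms mk.
  by rewrite -decode_mutate; apply: IHs => //; rewrite decode_mutate.
move=> _ /(mutation_class_edge dC)/and3P[d'C /implyP side /all_hnodesP cycE].
have sound c : c \in mutation_class -> sound_quiver (decode c).
  by move=> cC; apply: sound_quiverbP; apply: (allP mutation_class_sound).
apply: admissible_sound side _; rewrite -?decode_mutate; try exact: sound.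
by move=> x; apply: same_cyclicbP.
Qed.

Theorem proposition8p2 :
  [/\ ordered_mixed_quiver Q2, ST_compatible Q2, structure_T Q2 & fruitful Q2].
Proof.
have [omQ _ TQ] := Q2_sound.
split=> //; first exact: Q2_ST_compatible.
have <- : decode (encode Q2) = Q2 by apply: encodeK.
apply: mutation_class_fruitful.
by vm_compute.
Qed.
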